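(* For every fixed integer $k\ge 2$, $$r_{odd}\left(\mathcal{K}^{(k)}_{n,\dots,n},\ \mathcal{K}_{1,\dots,1,2,2}\right)=\frac{n}{2}+o(n)\qquad\text{as } n\to\infty.$$
   Context: $\mathcal{K}^{(k)}_{n_1,\dots,n_k}$ denotes the complete $k$-partite $k$-uniform hypergraph with pairwise disjoint vertex parts of sizes $n_1,\dots,n_k$: its edges are all $k$-sets containing exactly one vertex from each part. $\mathcal{K}^{(k)}_{n,\dots,n}$ has $k$ parts each of size $n$, and $\mathcal{K}_{1,\dots,1,2,2}$ is the $k$-uniform complete $k$-partite hypergraph with $k-2$ parts of size $1$ and two parts of size $2$ (so it has $4$ edges; for $k=2$ it is the graph $K_{2,2}$). For a hypergraph $G$ and a subhypergraph $H$ of $G$, a copy of $H$ in $G$ is a subhypergraph of $G$ isomorphic to $H$ (not necessarily induced). Given an edge-coloring of $G$ (an arbitrary assignment of a color to each edge), the color class of a color is the set of all edges of $G$ receiving that color. The odd Ramsey number $r_{odd}(G,H)$ is the minimum number of colors needed to edge-color $G$ so that every copy of $H$ in $G$ intersects some color class in an odd number of edges. The term $o(n)$ denotes a function $g(n)$, possibly depending on $k$, with $g(n)/n\to 0$ as $n\to\infty$ with $k$ fixed. *)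

(* Defs.v *)
From mathcomp Require Import all_boot.

Set Implicit Arguments.
Unset Strict Implicit.
Unset Printing Implicit Defensive.

Record hypergraph := Hypergraph {
  vertex :> finType;
  edges : {set {set vertex}}
}.

(* Vertices are pairs (part i, index inside part i). *)
Definition complete_partite (k : nat) (s : 'I_k -> nat) : hypergraph :=
  @Hypergraph {i : 'I_k & 'I_(s i)}
    [set e : {set {i : 'I_k & 'I_(s i)}} |
      (#|e| == k) && [forall i, #|[set v in e | tag v == i]| == 1]].

Definition K_balanced (k n : nat) : hypergraph :=
  @complete_partite k (fun=> n).

(* For k >= 2 the first k - 2 parts are singletons and the last two parts
   have size 2; for k < 2 this is a junk value. *)
Definition K_1122 (k : nat) : hypergraph :=
  @complete_partite k (fun i => if i < k - 2 then 1 else 2).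

(* (W, F) is a subhypergraph of G, with vertex set W and edge set F. *)
Definition subhypergraph (G : hypergraph) (W : {set G}) (F : {set {set G}}) :=
  (F \subset edges G) && [forall e in F, e \subset W].

(* f is an isomorphism from H onto the hypergraph (W, F). *)
Definition isomorphism (H G : hypergraph) (W : {set G}) (F : {set {set G}})
    (f : {ffun H -> G}) :=
  [&& injectiveb f, f @: [set: H] == W &
      [set f @: (e : {set H}) | e in edges H] == F].

Definition is_copy (G H : hypergraph) (W : {set G}) (F : {set {set G}}) :=
  subhypergraph W F && [exists f : {ffun H -> G}, isomorphism W F f].

Definition edge_coloring (G : hypergraph) (m : nat) :=
  {ffun {e : {set G} | e \in edges G} -> 'I_m}.

Definition color_class (G : hypergraph) (m : nat) (col : edge_coloring G m)
    (c : 'I_m) : {set {set G}} :=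
  [set val e | e in [set e | col e == c]].

Definition odd_coloring (G H : hypergraph) (m : nat)
    (col : edge_coloring G m) :=
  [forall W : {set G}, forall F : {set {set G}}, is_copy H W F ==>
    [exists c : 'I_m, odd #|F :&: color_class col c|]].

Definition odd_colorable (G H : hypergraph) (m : nat) :=
  [exists col : edge_coloring G m, odd_coloring H col].

(* A rainbow coloring works as soon as H has an edge. *)
Lemma odd_colorable_ex (G H : hypergraph) :
  edges H != set0 -> exists m, odd_colorable G H m.
Proof.
case/set0Pn=> e He.
exists #|{: {e : {set G} | e \in edges G}}|.
apply/existsP; exists [ffun x => enum_rank x].
apply/forallP=> W; apply/forallP=> F; apply/implyP.
case/andP=> /andP[/subsetP FG _] /existsP[f /and3P[_ _ /eqP FE]].
have fF : f @: e \in F by rewrite -FE; apply: imset_f.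
have fG := FG _ fF.
apply/existsP; exists (enum_rank (exist _ (f @: e) fG)).
suff -> : F :&: color_class [ffun x => enum_rank x]
    (enum_rank (exist _ (f @: e) fG)) = [set f @: e] by rewrite cards1.
apply/setP=> x; rewrite !inE; apply/andP/eqP => [[_ /imsetP[y]]|->].
  by rewrite inE ffunE => /eqP/enum_rank_inj -> ->.
by split=> //; apply/imsetP; exists (exist _ (f @: e) fG); rewrite ?inE ?ffunE.
Qed.

(* H_edge is needed: an edgeless H gives copies that no coloring can make odd. *)
Definition r_odd (G H : hypergraph) (H_edge : edges H != set0) : nat :=
  ex_minn (odd_colorable_ex G H_edge).

Lemma complete_partite_edge (k : nat) (s : 'I_k -> nat) :
  (forall i, 0 < s i) -> edges (complete_partite s) != set0.
Proof.
move=> s0; pose g i : {i : 'I_k & 'I_(s i)} := Tagged _ (Ordinal (s0 i)).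
have gK : injective g by move=> i j /(congr1 tag).
apply/set0Pn; exists [set g i | i in 'I_k]; rewrite inE.
rewrite card_imset // card_ord eqxx /=; apply/forallP=> i.
apply/cards1P; exists (g i); apply/setP=> v; rewrite !inE.
apply/andP/eqP=> [[/imsetP[j _ ->] /= /eqP ->] //|->].
by split=> //; apply: imset_f.
Qed.

Lemma K_1122_edge (k : nat) : edges (K_1122 k) != set0.
Proof. by apply: complete_partite_edge => i; case: ifP. Qed.

(* Main.v *)
(* A copy of K_{1,...,1,2,2} is a rectangle: fix all but two coordinates p, q of
   a cell in [n]^k and let these two take two values each.  It meets every color
   in an even number of edges iff its four corners have equal colors along two
   parallel sides, or on both diagonals.

   Lower bound: fix all but two coordinates.  If no rectangle has equal
   colors along two parallel sides, any two rows of the resulting n x n matrix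
   agree in at most one column; counting agreements in each column gives
   n <= 2m for m colors.

   Upper bound: for r odd, coloring a cell of (Z_r)^k by +-(sum of coordinates)
   uses (r+1)/2 colors and never colors parallel sides equally, but
   has many bad diagonals.  Replace each vertex i by pairs (i, x), x in R^E,
   and add to the color of a cell, for each s in E, an affine form in the x's
   whose coefficients depend on the cell.  One s is devoted to each bad
   rectangle: there the coefficients are chosen so that the two diagonal
   equations have the same linear part and different constant terms, while
   otherwise cells have distinct generic coefficients, which handles the
   rectangles with fewer than four distinct underlying cells.  Both the number
   of vertices and the number of colors get multiplied by |R^E|, so the ratio
   stays (r+1)/(2r); a last such step with |E| = 1 and R = Z_l, with l in an
   arithmetic progression, reaches all n up to a bounded error. *)

Require Import Defs.
From mathcomp Require Import all_boot all_order all_algebra.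
From mathcomp Require Import all_classical all_reals all_analysis.
From mathcomp Require Import zify ring lra.
Set Implicit Arguments.
Unset Strict Implicit.
Unset Printing Implicit Defensive.
Import Order.TTheory GRing.Theory Num.Theory.
Import numFieldNormedType.Exports.
Local Open Scope ring_scope.

(** * Rectangles of cells and their bad color patterns *)

Definition rect (k : nat) (T : Type) (f : {ffun 'I_k -> T}) (p q : 'I_k)
    (a b : T) : {ffun 'I_k -> T} :=
  [ffun t => if t == p then a else if t == q then b else f t].

(** Only sides in direction [q] are compared; since [(p, q)] ranges over all ordered pairs, [rectC]
    yields the sides in direction [p]. *)
Definition no_parallel (k : nat) (T C : Type) (c : {ffun 'I_k -> T} -> C) :=
  forall f p q a a' b b', p != q -> a <> a' -> b <> b' ->
    c (rect f p q a b) = c (rect f p q a b') ->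
    c (rect f p q a' b) = c (rect f p q a' b') -> False.

Definition no_crossing (k : nat) (T C : Type) (c : {ffun 'I_k -> T} -> C) :=
  forall f p q a a' b b', p != q -> a <> a' -> b <> b' ->
    c (rect f p q a b) = c (rect f p q a' b') ->
    c (rect f p q a b') = c (rect f p q a' b) -> False.

Lemma rectC (k : nat) (T : Type) (f : {ffun 'I_k -> T}) p q a b :
  p != q -> rect f p q a b = rect f q p b a.
Proof.
move=> pq; apply/ffunP=> t; rewrite !ffunE.
by case: eqVneq => [->|//]; rewrite (negbTE pq).
Qed.

Lemma rect_neql (k : nat) (T : Type) (f : {ffun 'I_k -> T}) p q a a' b b' :
  a <> a' -> rect f p q a b <> rect f p q a' b'.
Proof. by move=> aa /ffunP/(_ p); rewrite !ffunE eqxx. Qed.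

Lemma rect_neqr (k : nat) (T : Type) (f : {ffun 'I_k -> T}) p q a a' b b' :
  p != q -> b <> b' -> rect f p q a b <> rect f p q a' b'.
Proof.
by move=> pq bb /ffunP/(_ q); rewrite !ffunE eqxx eq_sym (negbTE pq).
Qed.

(** * Blow-up of a coloring by affine forms *)

Definition mul_cancel (R : pzRingType) (x : R) := forall z, x * z = 0 -> z = 0.

Definition blowup (k : nat) (T C : Type) (E : finType) (R : pzRingType)
    (c : {ffun 'I_k -> T} -> C) (m : E -> 'I_k -> {ffun 'I_k -> T} -> R)
    (e : E -> {ffun 'I_k -> T} -> R)
    (v : {ffun 'I_k -> T * {ffun E -> R}}) : C * {ffun E -> R} :=
  let i := [ffun t => (v t).1] in
  (c i, [ffun s => \sum_t m s t i * (v t).2 s + e s i]).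

(** Isolates the unknowns [x] and [y], so that equal colors at two corners give a linear equation
    for each [s]. *)
Lemma blowup_rect (k : nat) (T C : Type) (E : finType) (R : pzRingType)
    (c : {ffun 'I_k -> T} -> C) (m : E -> 'I_k -> {ffun 'I_k -> T} -> R)
    (e : E -> {ffun 'I_k -> T} -> R) f p q a b (x y : {ffun E -> R}) :
  p != q ->
  blowup c m e (rect f p q (a, x) (b, y)) =
  let i := rect [ffun t => (f t).1] p q a b in
  (c i, [ffun s => m s p i * x s + m s q i * y s +
     (\sum_(t | (t != p) && (t != q)) m s t i * (f t).2 s + e s i)]).
Proof.
move=> pq; rewrite /blowup /=.
have -> : [ffun t => (rect f p q (a, x) (b, y) t).1] =
    rect [ffun t => (f t).1] p q a b.
  apply/ffunP=> t; rewrite !ffunE.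
  by case: ifP => // _; case: ifP.
congr pair; apply/ffunP=> s; rewrite !ffunE.
rewrite (bigD1 p) //= ffunE eqxx (bigD1 q) 1?eq_sym //= ffunE eqxx.
rewrite eq_sym (negbTE pq) /= -!addrA; congr (_ + (_ + (_ + _))).
by apply: eq_bigr => t /andP[tp tq]; rewrite ffunE (negbTE tp) (negbTE tq).
Qed.

Lemma eq0B (V : zmodType) (u v z : V) : u = 0 -> v = 0 -> z = u - v -> z = 0.
Proof. by move=> -> -> ->; rewrite subr0. Qed.

Lemma eq0D (V : zmodType) (u v z : V) : u = 0 -> v = 0 -> z = u + v -> z = 0.
Proof. by move=> -> -> ->; rewrite addr0. Qed.

(** If [a = a'] or [b = b'], the color equations combine to cancellable factors times [x - x'] or
    [y - y']. Otherwise the four underlying cells are distinct: [c] itself excludes parallel sides,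
    and the index [s] of the last hypothesis excludes crossings. *)
Lemma blowup_strong (k : nat) (T C : eqType) (E : finType) (R : comPzRingType)
    (c : {ffun 'I_k -> T} -> C) (m : E -> 'I_k -> {ffun 'I_k -> T} -> R)
    (e : E -> {ffun 'I_k -> T} -> R) :
  no_parallel c ->
  mul_cancel (2%:R : R) ->
  (forall s t i, mul_cancel (m s t i)) ->
  (forall s t i i', i <> i' -> c i = c i' ->
     mul_cancel (m s t i - m s t i') /\ mul_cancel (m s t i + m s t i')) ->
  (forall f p q a a' b b', p != q -> a <> a' -> b <> b' ->
    c (rect f p q a b) = c (rect f p q a' b') ->
    c (rect f p q a b') = c (rect f p q a' b) ->
    exists s,
    [/\ forall t, t != q ->
          m s t (rect f p q a b') = m s t (rect f p q a b) /\
          m s t (rect f p q a' b) = m s t (rect f p q a' b'),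
        m s q (rect f p q a' b) = - m s q (rect f p q a b),
        m s q (rect f p q a b') = - m s q (rect f p q a' b') &
        e s (rect f p q a b) - e s (rect f p q a' b') <>
        e s (rect f p q a b') - e s (rect f p q a' b)]) ->
  no_parallel (blowup c m e) /\ no_crossing (blowup c m e).
Proof.
move=> par two unit diff kill.
have eq_ffun (x x' : {ffun E -> R}) : (forall s, x s - x' s = 0) -> x = x'.
  by move=> xx; apply/ffunP=> s; apply/eqP; rewrite -subr_eq0 xx.
have eq0 (x x' : {ffun E -> R}) : x = x' -> forall s, x s - x' s = 0.
  by move=> -> s; rewrite subrr.
split=> f p q [a x] [a' x'] [b y] [b' y'] pq ax bY; rewrite !blowup_rect //=.
  case=> cA /eq0 fA [cC /eq0 fC].
  case: (eqVneq b b') => [?|/eqP bb].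
    subst b'; apply: bY; congr pair; apply: eq_ffun => s.
    apply: (unit s q (rect [ffun t => (f t).1] p q a b)).
    by have := fA s; rewrite !ffunE => <-; ring.
  case: (eqVneq a a') => [?|/eqP aa]; last exact: par pq aa bb cA cC.
  subst a'; apply: ax; congr pair; apply: eq_ffun => s.
  have [] := diff s p _ _ (rect_neqr pq bb) cA; move=> + _; apply.
  by have := fA s; have := fC s; rewrite !ffunE => h1 h2;
    apply: (eq0B h2 h1); ring.
case=> cA /eq0 fA [cC /eq0 fC].
case: (eqVneq a a') => [?|/eqP aa].
  subst a'; apply: ax; congr pair; apply: eq_ffun => s.
  case: (eqVneq b b') => [?|/eqP bb].
    (* All four underlying cells coincide; the two equations add up to
       [2 * m s p i * (x s - x' s) = 0]. *)
    subst b'; apply: two.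
    apply: (unit s p (rect [ffun t => (f t).1] p q a b)).
    by have := fA s; have := fC s; rewrite !ffunE => h1 h2;
      apply: (eq0D h2 h1); ring.
  have [] := diff s p _ _ (rect_neqr pq bb) cA; move=> _; apply.
  by have := fA s; have := fC s; rewrite !ffunE => h1 h2;
    apply: (eq0D h2 h1); ring.
case: (eqVneq b b') => [?|/eqP bb].
  subst b'; apply: bY; congr pair; apply: eq_ffun => s.
  have [] := diff s q _ _ (rect_neql aa) cA; move=> _; apply.
  by have := fA s; have := fC s; rewrite !ffunE => h1 h2;
    apply: (eq0B h2 h1); ring.
(* For this [s] both diagonal equations have the same linear part, so their difference involves [e]
   alone. *)
have [s [mt mq mq' es]] := kill _ _ _ _ _ _ _ pq aa bb cA cC.
apply: es; apply/eqP; rewrite -subr_eq0; apply/eqP.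
have [mpB mpC] := mt p pq.
have := fA s; have := fC s; rewrite !ffunE mpB mpC mq mq'.
have -> : \sum_(t | (t != p) && (t != q))
    m s t (rect [ffun t0 => (f t0).1] p q a b') * (f t).2 s =
  \sum_(t | (t != p) && (t != q))
    m s t (rect [ffun t0 => (f t0).1] p q a b) * (f t).2 s.
  by apply: eq_bigr => t /andP[_ /mt[-> _]].
have -> : \sum_(t | (t != p) && (t != q))
    m s t (rect [ffun t0 => (f t0).1] p q a' b) * (f t).2 s =
  \sum_(t | (t != p) && (t != q))
    m s t (rect [ffun t0 => (f t0).1] p q a' b') * (f t).2 s.
  by apply: eq_bigr => t /andP[_ /mt[_ ->]].
by move=> h1 h2; apply: (eq0B h2 h1); ring.
Qed.

(** * Integers that are cancellable modulo a suitable number *)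

Lemma mul_cancel_unit (R : unitRingType) (x : R) :
  x \is a GRing.unit -> mul_cancel x.
Proof. by move=> ux z xz; rewrite -(mulKr ux z) xz mulr0. Qed.

Lemma mul_cancelN (R : pzRingType) (x : R) : mul_cancel x -> mul_cancel (- x).
Proof. by move=> hx z /eqP; rewrite mulNr oppr_eq0 => /eqP /hx. Qed.

(* Chosen so that sums and differences of distinct labels in [1, K] are units,
   with w free for padding. *)
Definition modulus (K w : nat) := (((2 * K.+1)`! * w.+1).+1)%N.

Lemma modulus_gt1 K w : (1 < modulus K w)%N.
Proof. by rewrite ltnS muln_gt0 fact_gt0. Qed.

(** [n] divides the factorial, so the modulus is 1 modulo [n]. *)
Lemma modulus_cancel (K w n : nat) : (0 < n <= 2 * K.+1)%N ->
  mul_cancel (n%:R : 'Z_(modulus K w)).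
Proof.
move=> nK; apply: mul_cancel_unit; rewrite unitZpE ?modulus_gt1 //.
have /dvdnP[d dE] : (n %| (2 * K.+1)`! * w.+1)%N.
  by rewrite dvdn_mulr ?dvdn_fact.
by rewrite /modulus -addn1 dE coprime_sym /coprime gcdnMDl gcdn1.
Qed.

Lemma modulus_cancelB (K w a b : nat) : (0 < a <= K)%N -> (0 < b <= K)%N ->
  a != b -> mul_cancel (a%:R - b%:R : 'Z_(modulus K w)).
Proof.
wlog ab : a b / (a < b)%N => [hw aK bK|/andP[a0 aK] /andP[b0 bK] _].
  case: ltngtP => // ab _; first by apply: hw => //; rewrite neq_ltn ab.
  by rewrite -opprB; apply/mul_cancelN/hw => //; rewrite neq_ltn ab.
rewrite -opprB; apply: mul_cancelN; rewrite -natrB 1?ltnW //.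
by apply: modulus_cancel; rewrite subn_gt0 ab; lia.
Qed.

Lemma modulus_cancelD (K w a b : nat) : (0 < a <= K)%N -> (0 < b <= K)%N ->
  mul_cancel (a%:R + b%:R : 'Z_(modulus K w)).
Proof.
by move=> aK bK; rewrite -natrD; apply: modulus_cancel; lia.
Qed.

(** Ranks are shifted by one because the label 0 would not be cancellable. *)
Definition label (X : finType) (x : X) : nat := (enum_rank x).+1.

Lemma label_bound (X : finType) (x : X) : (0 < label x <= #|X|)%N.
Proof. exact: ltn_ord. Qed.

Lemma label_inj (X : finType) : injective (@label X).
Proof. by move=> x y [/ord_inj /enum_rank_inj]. Qed.

(** * Signed labels as coefficients, and removal of crossings *)

Section Labelled.
Variables (k : nat) (T C E : finType) (c : {ffun 'I_k -> T} -> C) (w : nat).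
Notation cell := {ffun 'I_k -> T}.
Notation R := ('Z_(modulus #|{: cell}| w)).
Variables (sg : E -> 'I_k -> cell -> bool) (rho : E -> 'I_k -> cell -> cell).
Hypothesis rho_inj : forall s t i i',
  c i = c i' -> rho s t i = rho s t i' -> i = i'.

(** Sums and differences of distinct labels are both cancellable, so the signs [sg] can be chosen
    freely. Only cells of equal color are compared, hence [rho] need be injective only on each color
    class. *)
Definition coef (s : E) t i : R := (-1) ^+ sg s t i * (label (rho s t i))%:R.

Lemma coef_blowup (e : E -> cell -> R) :
  no_parallel c ->
  (forall f p q a a' b b', p != q -> a <> a' -> b <> b' ->
    c (rect f p q a b) = c (rect f p q a' b') ->
    c (rect f p q a b') = c (rect f p q a' b) ->
    exists s,
    [/\ forall t, t != q ->
          coef s t (rect f p q a b') = coef s t (rect f p q a b) /\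
          coef s t (rect f p q a' b) = coef s t (rect f p q a' b'),
        coef s q (rect f p q a' b) = - coef s q (rect f p q a b),
        coef s q (rect f p q a b') = - coef s q (rect f p q a' b') &
        e s (rect f p q a b) - e s (rect f p q a' b') <>
        e s (rect f p q a b') - e s (rect f p q a' b)]) ->
  no_parallel (blowup c coef e) /\ no_crossing (blowup c coef e).
Proof.
move=> par kill; apply: (blowup_strong par) => //.
- by apply: (@modulus_cancel _ _ 2); lia.
- move=> s t i; rewrite /coef; have /andP[l0 lb] := label_bound (rho s t i).
  case: (sg s t i); rewrite ?mulN1r ?mul1r; [apply: mul_cancelN|];
    by apply: modulus_cancel; rewrite l0 (leq_trans lb) //
      mul2n -addnn leqW ?leq_addr.
move=> s t i i' ii cii.
have lab : label (rho s t i) != label (rho s t i').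
  by apply/eqP => /label_inj /(rho_inj cii).
have lB := @modulus_cancelB _ w _ _ (label_bound _) (label_bound _) lab.
have lD := @modulus_cancelD _ w _ _ (label_bound (rho s t i))
  (label_bound (rho s t i')).
have lBN := mul_cancelN lB; have lDN := mul_cancelN lD.
rewrite opprB in lBN; rewrite opprD in lDN.
rewrite /coef; case: (sg s t i); case: (sg s t i').
all: rewrite ?mulN1r ?mul1r ?opprK; split=> //; by rewrite addrC.
Qed.
End Labelled.

(* [s = (A, B, B', A', q)] where A, A' and B, B' are opposite corners and the
   sides AB and B'A' are in direction q. *)
Definition crossing_cells (k : nat) (T C : finType) (c : {ffun 'I_k -> T} -> C)
    (s : {ffun 'I_k -> T} * {ffun 'I_k -> T} * {ffun 'I_k -> T} *
         {ffun 'I_k -> T} * 'I_k) :=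
  let: (A, B, B', A', _) := s in
  [&& c A == c A', c B == c B', c A != c B, A != A' & B != B'].

Lemma strong_blowup (k : nat) (T C : finType) (c : {ffun 'I_k -> T} -> C) :
  no_parallel c ->
  exists (E : finType) (l : nat)
    (c' : {ffun 'I_k -> T * {ffun E -> 'Z_l}} -> C * {ffun E -> 'Z_l}),
    [/\ (1 < l)%N, no_parallel c' & no_crossing c'].
Proof.
move=> par.
pose cell := {ffun 'I_k -> T}.
pose E : finType := (cell * cell * cell * cell * 'I_k)%type.
pose sg (s : E) (t : 'I_k) (i : cell) : bool :=
  let: (A, B, B', A', q) := s in
  [&& crossing_cells c s, t == q & (i == B) || (i == B')].
(* On the rectangle of s, the coefficient of x_q changes sign along the sides
   AB' and A'B, and that of any other x_t is constant along AB and A'B'. *)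
pose rho (s : E) (t : 'I_k) (i : cell) : cell :=
  let: (A, B, B', A', q) := s in
  if crossing_cells c s then
    if i == B then (if t == q then A' else A)
    else if i == B' then (if t == q then A else A') else i
  else i.
pose e (s : E) (i : cell) : 'Z_(modulus #|{: cell}| 0) := (i == s.1.1.1.1)%:R.
exists E, (modulus #|{: cell}| 0), (blowup c (coef 0 sg rho) e).
suff [] : no_parallel (blowup c (coef 0 sg rho) e) /\
  no_crossing (blowup c (coef 0 sg rho) e) by split=> //; exact: modulus_gt1.
apply: coef_blowup => //.
  (* Only [B] and [B'] are relabelled. They receive [A] and [A'] in some order, and these have
     another color, so no label repeats within the class of [B]. *)
  move=> [[[[A B] B'] A'] q] t i i' cii; rewrite /rho.
  case: ifP => // /and5P[/eqP cA /eqP cB cAB AA' BB'].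
  set V := if t == q then A' else A; set W := if t == q then A else A'.
  have cV : c V = c A by rewrite /V; case: ifP.
  have cW : c W = c A by rewrite /W; case: ifP.
  have VW : V <> W by rewrite /V /W; case: ifP => _ AA; rewrite AA eqxx in AA'.
  have out x : c x = c B -> c x = c A -> False.
    by move=> -> AB; rewrite AB eqxx in cAB.
  case: (eqVneq i B) => [iB|iB]; case: (eqVneq i' B) => [i'B|i'B].
  - by rewrite iB i'B.
  - case: (eqVneq i' B') => [//|_ Vi']; case: (out i'); last by rewrite -Vi'.
    by rewrite -cii iB.
  - case: (eqVneq i B') => [_ /esym //|_ Vi]; case: (out i); last by rewrite Vi.
    by rewrite cii i'B.
  case: (eqVneq i B') => [iB'|iB']; case: (eqVneq i' B') => [i'B'|i'B'] //.
  - by rewrite iB' i'B'.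
  - move=> Wi'; case: (out i'); last by rewrite -Wi'.
    by rewrite -cii iB'.
  - move=> Wi; case: (out i); last by rewrite Wi.
    by rewrite cii i'B'.
move=> f p q a a' b b' pq aa bb cA cB.
set A := rect f p q a b in cA *; set A' := rect f p q a' b' in cA *.
set B := rect f p q a b' in cB *; set B' := rect f p q a' b in cB *.
(* Otherwise all four corners would share one color, giving parallel sides. *)
have cAB : c A != c B.
  by apply/eqP => AB; apply: (par _ _ _ _ _ _ _ pq aa bb AB); rewrite -cA -cB.
have AA' : A != A' by apply/eqP/rect_neql.
have BB' : B != B' by apply/eqP/rect_neql.
have AB : A != B by apply/eqP/rect_neqr.
have AB' : A != B' by apply/eqP/rect_neql.
have A'B : A' != B by rewrite eq_sym; apply/eqP/rect_neql.
have A'B' : A' != B' by rewrite eq_sym; apply/eqP/rect_neqr.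
exists (A, B, B', A', q).
have ok : crossing_cells c (A, B, B', A', q).
  by rewrite /crossing_cells cAB AA' BB' cA cB !eqxx.
split; rewrite /coef /sg /rho ?ok ?eqxx /= ?(negbTE AB) ?(negbTE AB')
  ?(negbTE A'B) ?(negbTE A'B') ?eqxx ?(eq_sym B') ?(negbTE BB') /=
  ?mulN1r ?mul1r //.
  by move=> t /negbTE ->.
(* As [e] is the indicator of [A], the constants differ by 1 along [AA'] and by 0 along [BB']. *)
rewrite /e /= eqxx !(eq_sym _ A) (negbTE AA') (negbTE AB) (negbTE AB').
by move/eqP; rewrite subr0 subrr oner_eq0.
Qed.

(** Without crossings in [c] there is nothing to kill, so plain labels suffice; the free [w] makes
    the size of [Q] adjustable. *)
Lemma pad_blowup (k : nat) (T C : finType) (c : {ffun 'I_k -> T} -> C) w :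
  no_parallel c -> no_crossing c ->
  let Q := {ffun unit -> 'Z_(modulus #|{ffun 'I_k -> T}| w)} in
  exists c' : {ffun 'I_k -> T * Q} -> C * Q,
    no_parallel c' /\ no_crossing c'.
Proof.
move=> par cross.
exists (blowup c (coef w (fun (_ : unit) _ _ => false) (fun _ _ i => i))
  (fun _ _ => 0)).
apply: coef_blowup => // f p q a a' b b' pq aa bb cA cB.
by case: (cross _ _ _ _ _ _ _ pq aa bb cA cB).
Qed.

(** * The base coloring modulo an odd number and its blow-ups *)

Lemma card_ffun_Zp (E : finType) (l : nat) : (1 < l)%N ->
  #|{: {ffun E -> 'Z_l}}| = (l ^ #|E|)%N.
Proof. by move=> l1; rewrite card_ffun card_ord Zp_cast. Qed.

(** The class of [u] up to sign: for the odd modulus [r = 2h + 3] there are [h + 2 = (r + 1) / 2]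
    classes. *)
Definition abs_mod (h : nat) (u : 'Z_(h.*2.+3)) : 'I_h.+2 :=
  inord (minn u (h.*2.+3 - u)).

Lemma abs_mod_eq (h : nat) (u v : 'Z_(h.*2.+3)) :
  abs_mod u = abs_mod v -> u = v \/ u + v = 0.
Proof.
have ub := ltn_ord u; have vb := ltn_ord v; rewrite /= /Zp_trunc /= in ub vb.
move/(congr1 val); rewrite /= !inordK; [|lia|lia] => uv.
have [uv'|uv'] : u = v :> nat \/ (u + v = h.*2.+3)%N.
- by move: uv ub vb; move: (nat_of_ord u) (nat_of_ord v) => x y; lia.
- by left; apply: val_inj.
- by right; apply: val_inj; rewrite /= uv' modnn.
Qed.

(** As [b] and [b'] differ, each of the two equalities makes two sums opposite; subtracting gives
    [2 * (a - a') = 0], and 2 is invertible modulo an odd number. *)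
Lemma abs_mod_no_parallel (k h : nat) :
  no_parallel (fun i : {ffun 'I_k -> 'Z_(h.*2.+3)} => abs_mod (\sum_t i t)).
Proof.
move=> f p q a a' b b' pq aa bb.
have sumE x y : \sum_t rect f p q x y t =
    x + y + \sum_(t | (t != p) && (t != q)) f t.
  rewrite (bigD1 p) //= ffunE eqxx (bigD1 q) 1?eq_sym //= ffunE eqxx.
  rewrite eq_sym (negbTE pq) -!addrA; congr (_ + (_ + _)).
  by apply: eq_bigr => t /andP[tp tq]; rewrite ffunE (negbTE tp) (negbTE tq).
rewrite !sumE; move: (\sum_(t | _) _) => r.
have cancel x : x + b + r = x + b' + r -> b = b' by move/addIr/addrI.
move=> /abs_mod_eq[/cancel //|e1] /abs_mod_eq[/cancel //|e2].
have two : mul_cancel (2%:R : 'Z_(h.*2.+3)).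
  apply: mul_cancel_unit; rewrite unitZpE //.
  by rewrite coprimen2 /= odd_double.
apply: aa; apply/eqP; rewrite -subr_eq0; apply/eqP/two.
by apply: (eq0B e1 e2); ring.
Qed.

(** [N] and [L] are chosen before [w], so for fixed [h] the sizes of [T] form an arithmetic
    progression while the ratio of [#|C|] to [#|T|] stays fixed. *)
Lemma strong_coloring (k h : nat) :
  exists N L : nat, (0 < N)%N /\ (0 < L)%N /\ forall w, exists (T C : finType)
    (c : {ffun 'I_k -> T} -> C),
  [/\ no_parallel c, no_crossing c,
      #|T| = (h.*2.+3 * (N * (L * w.+1).+1))%N &
      #|C| = (h.+2 * (N * (L * w.+1).+1))%N].
Proof.
have [E [l [c [l1 par cross]]]] := strong_blowup (@abs_mod_no_parallel k h).
set T := (_ * _)%type in c par cross.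
exists (l ^ #|E|)%N, (2 * #|{ffun 'I_k -> T}|.+1)`!.
rewrite expn_gt0 (ltnW l1) fact_gt0; do 2!split=> //; move=> w.
have [c' [par' cross']] := pad_blowup w par cross.
do 3!eexists; split; [exact: par'|exact: cross'| |].
all: rewrite !card_prod !card_ffun_Zp ?modulus_gt1 //.
all: by rewrite card_unit expn1 card_ord -mulnA.
Qed.

(** * Edges of complete partite hypergraphs as choice functions *)

Definition transversal (k : nat) (s : 'I_k -> nat) (g : forall i, 'I_(s i)) :
  {set {i : 'I_k & 'I_(s i)}} :=
  [set Tagged (fun i => 'I_(s i)) (g i) | i : 'I_k].

Lemma in_transversal (k : nat) (s : 'I_k -> nat) (g : forall i, 'I_(s i)) v :
  (v \in transversal g) = (g (tag v) == tagged v).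
Proof.
case: v => i x /=; apply/imsetP/eqP => [[j _ jE]|<-]; last by exists i.
have ij : i = j := congr1 tag jE.
by subst j; rewrite (eq_from_Tagged jE).
Qed.

Lemma transversal_edge (k : nat) (s : 'I_k -> nat) (g : forall i, 'I_(s i)) :
  transversal g \in edges (complete_partite s).
Proof.
rewrite inE card_imset ?card_ord ?eqxx; last by move=> i j /(congr1 tag).
apply/forallP=> i; apply/cards1P; exists (Tagged (fun i => 'I_(s i)) (g i)).
apply/setP=> v; rewrite !inE in_transversal; case: v => j x /=.
apply/andP/eqP => [[/eqP gx /eqP ji]|jE]; first by subst j; rewrite -gx.
have ji := congr1 tag jE; rewrite /= in ji; subst j.
by rewrite (eq_from_Tagged jE) !eqxx.
Qed.

Lemma edge_transversal (k : nat) (s : 'I_k -> nat) e :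
  e \in edges (complete_partite s) ->
  exists g : forall i, 'I_(s i), e = transversal g.
Proof.
rewrite inE => /andP[_ /forallP he].
have /fin_all_exists[g hg] : forall i, exists x : 'I_(s i),
    [set v in e | tag v == i] = [set Tagged (fun i => 'I_(s i)) x].
  move=> i; have /cards1P[[j x] hx] := he i.
  have : Tagged (fun i => 'I_(s i)) x \in [set v in e | tag v == i].
    by rewrite hx set11.
  by rewrite inE => /andP[_ /= /eqP ji]; subst j; exists x.
exists g; apply/setP=> v; rewrite in_transversal.
have /setP/(_ v) := hg (tag v); rewrite !inE eqxx andbT => ->.
by case: v => j x /=; rewrite -tag_eqE /tag_eq /= eqxx /= tagged_asE eq_sym.
Qed.

Lemma transversal_inj (k : nat) (s : 'I_k -> nat) (g g' : forall i, 'I_(s i)) :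
  transversal g = transversal g' -> forall i, g i = g' i.
Proof.
move=> /setP gg i; have := gg (Tagged (fun i => 'I_(s i)) (g' i)).
by rewrite !in_transversal /= eqxx => /eqP.
Qed.

Lemma imset_transversal (k : nat) (s s' : 'I_k -> nat)
    (f : {i : 'I_k & 'I_(s i)} -> {i : 'I_k & 'I_(s' i)})
    (g : forall i, 'I_(s i)) (g' : forall i, 'I_(s' i)) :
  (forall i, f (Tagged (fun i => 'I_(s i)) (g i)) =
             Tagged (fun i => 'I_(s' i)) (g' i)) ->
  f @: transversal g = transversal g'.
Proof. by move=> fg; rewrite -imset_comp; apply: eq_imset => i; exact: fg. Qed.

Lemma card_setU1I (X : finType) (x : X) (A K : {set X}) : x \notin A ->
  #|(x |: A) :&: K| = ((x \in K) + #|A :&: K|)%N.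
Proof.
move=> xA; rewrite finset.setIUl cardsU.
have -> : [set x] :&: K :&: (A :&: K) = finset.set0.
  apply/setP=> y; rewrite !inE.
  by case: eqP => //= ->; rewrite (negbTE xA) andbF.
rewrite cards0 subn0; congr (_ + _)%N; case: (boolP (x \in K)) => xK.
  by rewrite (finset.setIidPl _) ?cards1 // finset.sub1set.
by apply/eqP; rewrite cards_eq0 finset.setI_eq0 finset.disjoints1.
Qed.

(** * Copies of [K_1122] as rectangles *)

Definition cell_color (k n m : nat) (col : edge_coloring (K_balanced k n) m)
    (g : {ffun 'I_k -> 'I_n}) : 'I_m :=
  col (exist _ (transversal (s := fun=> n) g)
         (transversal_edge (s := fun=> n) g)).

Lemma in_color_class (k n m : nat) (col : edge_coloring (K_balanced k n) m)
    (g : {ffun 'I_k -> 'I_n}) d :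
  (transversal (s := fun=> n) g \in color_class col d) =
  (cell_color col g == d).
Proof.
apply/imsetP/eqP => [[[e eG]]|<-]; last first.
  by exists (exist _ (transversal (s := fun=> n) g)
              (transversal_edge (s := fun=> n) g)); rewrite ?inE.
rewrite inE => /eqP <- /= ge; subst e; rewrite /cell_color.
by congr (col _); apply: val_inj.
Qed.

(* x is the index used in part k - 2 and y the one used in part k - 1. *)
Definition face_vertex (k : nat) (i : 'I_k) (x y : bool) :
    'I_(if (i < k - 2)%N then 1%N else 2%N) :=
  if (i < k - 2)%N as z return 'I_(if z then 1%N else 2%N) then ord0
  else inord (if i == (k - 2)%N :> nat then x else y).

Arguments face_vertex : simpl never.

Lemma face_vertexE (k : nat) (i : 'I_k) x y :
  face_vertex i x y =
  (if (i < k - 2)%N then 0 else if i == (k - 2)%N :> nat then x : nat else y)%N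
  :> nat.
Proof.
rewrite /face_vertex; case: (i < k - 2)%N => //.
by rewrite inordK //; case: ifP; case: x; case: y.
Qed.

Definition face (k : nat) (x y : bool) : {set K_1122 k} :=
  transversal (fun i => face_vertex i x y).

Lemma face_edge (k : nat) x y : face k x y \in edges (K_1122 k).
Proof. exact: transversal_edge. Qed.

Lemma edge_face (k : nat) e : (2 <= k)%N -> e \in edges (K_1122 k) ->
  exists x y, e = face k x y.
Proof.
move=> k2 /edge_transversal[g ->].
have pk : (k - 2 < k)%N by lia.
have qk : (k - 1 < k)%N by lia.
pose p := Ordinal pk; pose q := Ordinal qk.
exists (0 < g p)%N, (0 < g q)%N.
apply/setP=> v; rewrite !in_transversal; congr (_ == _).
apply: val_inj; rewrite /= face_vertexE; move: (tag v) => i {v}.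
have gb j : exists2 u, nat_of_ord (g j) = u &
    (u < if (j < k - 2)%N then 1 else 2)%N.
  by exists (g j) => //; exact: ltn_ord.
have [u gi] := gb i; rewrite gi; have := ltn_ord i.
case: (ltnP i (k - 2)) => [_ _|ki ik]; first by case: u {gi}.
have bool_lt2 w : (w < 2)%N -> w = (0 < w)%N by case: w => [|[]].
move/bool_lt2 => ->; rewrite -gi; case: eqP => [ip|ip].
  by have -> : i = p by apply: val_inj.
by have -> : i = q by apply: val_inj => /=; lia.
Qed.

(** Every color occurs an even number of times exactly when the four corners split into two equally
    colored pairs, and there are three ways to pair them. *)
Lemma odd_four_colors (C : eqType) (c00 c01 c10 c11 : C) :
  (exists d, odd ((c00 == d) + (c01 == d) + (c10 == d) + (c11 == d))%N) <->
  ~ (c00 = c01 /\ c10 = c11) /\ ~ (c00 = c10 /\ c01 = c11) /\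
  ~ (c00 = c11 /\ c01 = c10).
Proof.
split=> [[d od]|[par [par' cross]]].
  split; [|split]; case=> e1 e2; subst; move: od.
  - by case: (c01 == d); case: (c11 == d).
  - by case: (c10 == d); case: (c11 == d).
  - by case: (c10 == d); case: (c11 == d).
have [e1|n1] := eqVneq c00 c01.
  exists c10; rewrite -e1 eqxx; have [e2|n2] := eqVneq c11 c10.
    by case: par.
  by case: (c00 == c10).
have [e2|n2] := eqVneq c00 c10.
  exists c01; rewrite -e2 eqxx (negbTE n1).
  have [e3|//] := eqVneq c11 c01; by case: par'.
have [e3|n3] := eqVneq c00 c11.
  exists c01; rewrite -e3 eqxx (negbTE n1).
  have [e4|//] := eqVneq c10 c01; by case: cross.
by exists c00; rewrite eqxx !(eq_sym _ c00) (negbTE n1) (negbTE n2) (negbTE n3).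
Qed.

(** Serves both bounds: a copy enters only through the cells [g x y] of its four edges, which are
    distinct since [f] is injective. *)
Lemma odd_color_four (k n m : nat) (col : edge_coloring (K_balanced k n) m)
    (f : {ffun K_1122 k -> K_balanced k n})
    (F : {set {set K_balanced k n}})
    (g : bool -> bool -> {ffun 'I_k -> 'I_n}) :
  (2 <= k)%N -> injective f ->
  [set f @: (e : {set K_1122 k}) | e in edges (K_1122 k)] = F ->
  (forall x y, f @: face k x y = transversal (s := fun=> n) (g x y)) ->
  (exists d, odd #|F :&: color_class col d|) <->
  let c x y := cell_color col (g x y) in
  ~ (c false false = c false true /\ c true false = c true true) /\
  ~ (c false false = c true false /\ c false true = c true true) /\
  ~ (c false false = c true true /\ c false true = c true false).
Proof.
move=> k2 f_inj FE fg; rewrite /= -odd_four_colors.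
pose t x y := transversal (s := fun=> n) (g x y).
have face_neq x y x' y' : (x, y) != (x', y') -> t x y != t x' y'.
  move=> ne; rewrite /t -!fg.
  apply/eqP => /(imset_inj f_inj) /transversal_inj h.
  have pk : (k - 2 < k)%N by lia.
  have qk : (k - 1 < k)%N by lia.
  have := congr1 (@nat_of_ord _) (h (Ordinal pk)).
  have := congr1 (@nat_of_ord _) (h (Ordinal qk)).
  rewrite !face_vertexE /= ltnn eqxx.
  have -> : (k - 1 < k - 2)%N = false by lia.
  have -> : (k - 1 == k - 2)%N = false by lia.
  by move: ne {h}; case: x; case: x'; case: y; case: y'.
have {FE} FE : 
    F = t false false |: (t false true |: (t true false |:
        (t true true |: finset.set0))).
  apply/setP=> e; rewrite -FE !inE.
  apply/imsetP/idP => [[e' /(edge_face k2)[x [y ->]] ->]|].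
    by rewrite fg; case: x; case: y; rewrite eqxx ?orbT.
  rewrite orbF => /or4P[] /eqP ->;
    [exists (face k false false)|exists (face k false true)
    |exists (face k true false)|exists (face k true true)];
    rewrite ?face_edge ?fg //.
have card d : #|F :&: color_class col d| =
   ((cell_color col (g false false) == d) +
    (cell_color col (g false true) == d) +
    (cell_color col (g true false) == d) +
    (cell_color col (g true true) == d))%N.
  rewrite FE !card_setU1I ?inE ?negb_or ?face_neq //.
  by rewrite finset.set0I cards0 !in_color_class addn0 !addnA.
by split=> -[d od]; exists d; move: od; rewrite card.
Qed.

Lemma tag_in_transversal (k : nat) (s : 'I_k -> nat)
    (g : forall i, 'I_(s i)) v w :
  v \in transversal g -> w \in transversal g -> tag v = tag w -> v = w.
Proof.
case: v w => [i x] [j y]; rewrite !in_transversal /= => /eqP <- /eqP <- ij.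
by subst j.
Qed.

(** An isomorphism may permute the parts, so [P] and [Q] are read off from the images of the doubled
    parts [p] and [q] in one face; comparing faces that share all but one vertex shows that both
    vertices of [p] land in [P], and those of [q] in [Q]. *)
Lemma face_image_rect (k n : nat) (f : {ffun K_1122 k -> K_balanced k n})
    (g : bool -> bool -> {ffun 'I_k -> 'I_n}) :
  (2 <= k)%N -> injective f ->
  (forall x y, f @: face k x y = transversal (s := fun=> n) (g x y)) ->
  exists g0 P Q (a b : bool -> 'I_n),
    [/\ P != Q, a false != a true, b false != b true &
        forall x y, g x y = rect g0 P Q (a x) (b y)].
Proof.
move=> k2 f_inj fg.
have pk : (k - 2 < k)%N by lia.
have qk : (k - 1 < k)%N by lia.
pose p := Ordinal pk; pose q := Ordinal qk.
pose vtx i x y : K_1122 k := Tagged _ (face_vertex (i : 'I_k) x y).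
have vtx_face i x y : vtx i x y \in face k x y by rewrite in_transversal.
have face_vtx x y v : v \in face k x y -> v = vtx (tag v) x y.
  by move=> vf; apply: tag_in_transversal vf (vtx_face _ _ _) _.
have vtx_p x y y' : vtx p x y = vtx p x y'.
  by congr Tagged; apply: ord_inj; rewrite !face_vertexE eqxx.
have vtx_q x x' y : vtx q x y = vtx q x' y.
  congr Tagged; apply: ord_inj; rewrite !face_vertexE /=.
  by have -> : (k - 1 == k - 2)%N = false by lia.
have vtx_o i x x' y y' : i != p -> i != q -> vtx i x y = vtx i x' y'.
  move=> ip iq; congr Tagged; apply: ord_inj; rewrite !face_vertexE.
  have -> // : (i < k - 2)%N.
  by move: ip iq (ltn_ord i); rewrite -!val_eqE /=; lia.
have vtx_pn y y' : vtx p false y <> vtx p true y'.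
  move=> e0; have := congr1 (@nat_of_ord _) (eq_from_Tagged e0).
  rewrite !face_vertexE.
  by rewrite /= ltnn eqxx.
have vtx_qn x x' : vtx q x false <> vtx q x' true.
  move=> e0; have := congr1 (@nat_of_ord _) (eq_from_Tagged e0).
  rewrite !face_vertexE /=.
  have -> : (k - 1 == k - 2)%N = false by lia.
  by have -> : (k - 1 < k - 2)%N = false by lia.
have pq : p != q by rewrite -val_eqE /=; lia.
have ftr x y i : f (vtx i x y) \in transversal (s := fun=> n) (g x y).
  by rewrite -fg imset_f.
have fval x y i : tagged (f (vtx i x y)) = g x y (tag (f (vtx i x y))).
  by have := ftr x y i; rewrite in_transversal => /eqP.
have fsurj x y t : exists i, f (vtx i x y) = @Tagged _ t (fun=> 'I_n) (g x y t).
  have : @Tagged _ t (fun=> 'I_n) (g x y t) \in f @: face k x y.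
    by rewrite fg in_transversal.
  by case/imsetP => v /face_vtx -> ->; exists (tag v).
have vtx_inj x y i j : tag (f (vtx i x y)) = tag (f (vtx j x y)) -> i = j.
  by move=> /(tag_in_transversal (ftr x y i) (ftr x y j)) /f_inj /(congr1 tag).
pose P := tag (f (vtx p false false)); pose Q := tag (f (vtx q false false)).
(* Some vertex of [face k true false] lands in [P]. It is not shared with [face k false false],
   where only the other vertex of [p] does so; hence it is the new one. *)
have tagP : tag (f (vtx p true false)) = P.
  have [i fi] := fsurj true false P.
  have [ip|ip] := eqVneq i p; first by rewrite -ip fi.
  have [iq|iq] := eqVneq i q.
    move: fi; rewrite iq (vtx_q true false false) =>
      /(congr1 tag) /= /vtx_inj qp.
    by rewrite qp eqxx in pq.
  move: fi; rewrite (vtx_o _ true false false false ip iq).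
  by move=> /(congr1 tag) /= /vtx_inj ip'; rewrite ip' eqxx in ip.
have tagQ : tag (f (vtx q false true)) = Q.
  have [i fi] := fsurj false true Q.
  have [iq|iq] := eqVneq i q; first by rewrite -iq fi.
  have [ip|ip] := eqVneq i p.
    move: fi; rewrite ip (vtx_p false true false) =>
      /(congr1 tag) /= /vtx_inj qp.
    by rewrite qp eqxx in pq.
  move: fi; rewrite (vtx_o _ false false true false ip iq).
  by move=> /(congr1 tag) /= /vtx_inj iq'; rewrite iq' eqxx in iq.
exists (g false false), P, Q,
  (fun x => tagged (f (vtx p x false))), (fun y => tagged (f (vtx q false y))).
split.
- by apply/eqP => /vtx_inj pq'; rewrite pq' eqxx in pq.
- apply/eqP => e; case: (vtx_pn false false); apply: f_inj.
  move: e tagP; rewrite /P.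
  by case: (f _) => i u; case: (f _) => j v /= -> ->.
- apply/eqP => e; case: (vtx_qn false false); apply: f_inj.
  move: e tagQ; rewrite /Q.
  by case: (f _) => i u; case: (f _) => j v /= -> ->.
move=> x y; apply/ffunP=> t; rewrite ffunE.
have tagP' x' : tag (f (vtx p x' false)) = P by case: x'.
have tagQ' y' : tag (f (vtx q false y')) = Q by case: y'.
case: eqP => [->|tP].
  by rewrite -(tagP' x) (vtx_p x false y) fval.
case: eqP => [->|tQ].
  by rewrite -(tagQ' y) (vtx_q false x y) fval.
(* The remaining vertices are common to all faces, so these coordinates do not depend on [x] and
   [y]. *)
have [i fi] := fsurj x y t.
have ip : i != p.
  by apply/eqP => ip; apply: tP; rewrite -(tagP' x) (vtx_p x false y) -ip fi.
have iq : i != q.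
  by apply/eqP => iq; apply: tQ; rewrite -(tagQ' y) (vtx_q false x y) -iq fi.
have := fval false false i; rewrite (vtx_o i false x false y ip iq) fi /=.
by [].
Qed.

(** * Odd colorings versus rectangle conditions *)

Lemma strong_odd_coloring (k n m : nat)
    (col : edge_coloring (K_balanced k n) m) :
  (2 <= k)%N -> no_parallel (cell_color col) -> no_crossing (cell_color col) ->
  odd_coloring (K_1122 k) col.
Proof.
move=> k2 par cross; apply/forallP=> W; apply/forallP=> F; apply/implyP.
case/andP=> /andP[/fintype.subsetP FG _].
case/existsP=> [f /and3P[/injectiveP f_inj _ /eqP FE]].
have gex x y : exists g : {ffun 'I_k -> 'I_n},
    f @: face k x y == transversal (s := fun=> n) g.
  have /FG/edge_transversal[g ->] : f @: face k x y \in F.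
    by rewrite -FE imset_f // face_edge.
  by exists (finfun g); apply/eqP; apply: eq_imset => i; rewrite ffunE.
pose g x y := xchoose (gex x y).
have gE x y : f @: face k x y = transversal (s := fun=> n) (g x y).
  by apply/eqP; exact: xchooseP (gex x y).
have [g0 [P [Q [a [b [PQ aa bb gr]]]]]] := face_image_rect k2 f_inj gE.
apply/existsP; apply: (proj2 (odd_color_four col k2 f_inj FE gE)).
cbv zeta beta; rewrite !gr.
move/eqP: aa => aa; move/eqP: bb => bb.
split; [|split]; case=> e1 e2.
- exact: par PQ aa bb e1 e2.
(* Sides in direction [P]: the two directions are exchanged. *)
- rewrite eq_sym in PQ; apply: (par g0 Q P _ _ _ _ PQ bb aa).
    by rewrite !(rectC _ _ _ PQ); exact: e1.
  by rewrite !(rectC _ _ _ PQ); exact: e2.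
- exact: cross PQ aa bb e1 e2.
Qed.

(** Each rectangle in the last two directions comes from a copy: the doubled parts go to [a, a'] and
    [b, b'], the singletons to the values of [g]. *)
Lemma odd_coloring_no_parallel (k n m : nat)
    (col : edge_coloring (K_balanced k n) m) (pk : (k - 2 < k)%N)
    (qk : (k - 1 < k)%N) g a a' b b' :
  (2 <= k)%N -> odd_coloring (K_1122 k) col -> a <> a' -> b <> b' ->
  let c x y := cell_color col (rect g (Ordinal pk) (Ordinal qk) x y) in
  c a b = c a' b -> c a b' = c a' b' -> False.
Proof.
move=> k2 odd_col aa bb c.
pose val_f (v : K_1122 k) : 'I_n :=
  if tag v == Ordinal pk then (if tagged v == 0%N :> nat then a else a')
  else if tag v == Ordinal qk then (if tagged v == 0%N :> nat then b else b')
  else g (tag v).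
pose f : {ffun K_1122 k -> K_balanced k n} :=
  [ffun v => @Tagged _ (tag v) (fun=> 'I_n) (val_f v)].
have f_inj : injective f.
  move=> [i x] [j y]; rewrite !ffunE => e.
  have ij : i = j := congr1 tag e; subst j.
  have := eq_from_Tagged e; rewrite /val_f /=.
  have := ltn_ord x; have := ltn_ord y => yb xb vxy.
  suff xy : x = y :> nat by congr existT; exact: ord_inj.
  move: vxy xb yb; move: (nat_of_ord x) (nat_of_ord y) => {x y e}u v.
  case: eqP => [->|ip] /=.
    by rewrite ltnn; case: u v => [|[|u]] [|[|v]] // h; case: aa.
  case: eqP => [->|iq] /=.
    have -> : (k - 1 < k - 2)%N = false by lia.
    by case: u v => [|[|u]] [|[|v]] // h; case: bb.
  have -> : (i < k - 2)%N.
    have := ltn_ord i; have : nat_of_ord i <> (k - 2)%N.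
      by move=> h; apply: ip; apply: ord_inj.
    have : nat_of_ord i <> (k - 1)%N by move=> h; apply: iq; apply: ord_inj.
    by lia.
  by case: u v => [|u] [|v].
pose gg (x y : bool) := rect g (Ordinal pk) (Ordinal qk) (if x then a' else a)
  (if y then b' else b).
have fg x y : f @: face k x y = transversal (s := fun=> n) (gg x y).
  apply: imset_transversal => i; rewrite !ffunE.
  congr (@Tagged _ _ (fun=> 'I_n) _).
  rewrite /val_f /= face_vertexE /=.
  case: eqP => [->|_] /=; first by rewrite ltnn eqxx; case: x.
  case: eqP => [->|_] //=.
  have -> : (k - 1 < k - 2)%N = false by lia.
  have -> : (k - 1 == k - 2)%N = false by lia.
  by case: y.
pose F := [set f @: (e : {set K_1122 k}) | e in edges (K_1122 k)].
have copyF : is_copy (K_1122 k) (f @: [set: K_1122 k]) F.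
  apply/andP; split; last first.
    by apply/existsP; exists f; rewrite /isomorphism !eqxx !andbT;
      apply/injectiveP.
  apply/andP; split.
    apply/fintype.subsetP => e /imsetP[e' /(edge_face k2)[x [y ->]] ->].
    by rewrite fg; exact: transversal_edge.
  by apply/forall_inP => e /imsetP[e' _ ->]; apply: imsetS;
    exact: finset.subsetT.
have /forallP/(_ (f @: [set: K_1122 k]))/forallP/(_ F) := odd_col.
move=> /implyP/(_ copyF).
move=> /existsP[d od] e1 e2.
have [+ _] := odd_color_four col k2 f_inj (erefl F) fg.
by case; [exists d|move=> _ [+ _]; case].
Qed.

(** Both rectangle conditions survive restriction along an injection of the [n] indices into [T]. *)
Lemma strong_odd_colorable (k n : nat) (T C : finType)
    (c : {ffun 'I_k -> T} -> C) :
  (2 <= k)%N -> no_parallel c -> no_crossing c -> (n <= #|T|)%N ->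
  odd_colorable (K_balanced k n) (K_1122 k) #|C|.
Proof.
move=> k2 par cross nT.
pose emb (i : 'I_n) : T := enum_val (widen_ord nT i).
have emb_inj : injective emb.
  by move=> i j /enum_val_inj /(congr1 val) /= ij; apply: ord_inj.
have gex (e : {e : {set K_balanced k n} | e \in edges (K_balanced k n)}) :
    exists g : {ffun 'I_k -> 'I_n}, val e == transversal (s := fun=> n) g.
  have [g ->] := edge_transversal (valP e).
  by exists (finfun g); apply/eqP; apply: eq_imset => i; rewrite ffunE.
pose col : edge_coloring (K_balanced k n) #|C| :=
  [ffun e => enum_rank (c [ffun t => emb (xchoose (gex e) t)])].
have colE g : cell_color col g = enum_rank (c [ffun t => emb (g t)]).
  rewrite /cell_color ffunE; congr (enum_rank (c _)); apply/ffunP=> t.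
  rewrite !ffunE; congr emb; apply: esym.
  by move: t; apply: transversal_inj; apply/eqP; exact: xchooseP (gex _).
have rectE g p q a b : [ffun t => emb (rect g p q a b t)] =
    rect [ffun t => emb (g t)] p q (emb a) (emb b).
  by apply/ffunP=> t; rewrite !ffunE; case: ifP => // _; case: ifP.
apply/existsP; exists col; apply: strong_odd_coloring => //.
  move=> g p q a a' b b' pq aa bb; rewrite !colE !rectE => /enum_rank_inj e1.
  move=> /enum_rank_inj e2; apply: (par _ _ _ _ _ _ _ pq _ _ e1 e2).
    by move/emb_inj.
  by move/emb_inj.
move=> g p q a a' b b' pq aa bb; rewrite !colE !rectE => /enum_rank_inj e1.
move=> /enum_rank_inj e2; apply: (cross _ _ _ _ _ _ _ pq _ _ e1 e2).
  by move/emb_inj.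
by move/emb_inj.
Qed.

(** * Lower bound by counting agreements *)

Lemma sum_fiber (A B : finType) (F : A -> B) :
  (\sum_(y : B) #|[set x | F x == y]| = #|A|)%N.
Proof.
rewrite -cardsT -sum1_card (partition_big F predT) //=; apply: eq_bigr => y _.
by rewrite -sum1_card; apply: eq_bigl => x; rewrite !inE.
Qed.

Lemma sum_fiber_sqr (A B : finType) (F : A -> B) :
  (\sum_(x : A) \sum_(x' : A) (F x == F x') =
   \sum_(y : B) #|[set x | F x == y]| ^ 2)%N.
Proof.
rewrite (partition_big F predT) //=; apply: eq_bigr => y _.
rewrite (eq_bigr (fun=> #|[set x | F x == y]|)) => [|x /eqP Fx].
  by rewrite sum_nat_const -mulnn cardsE.
rewrite -sum1_card [RHS]big_mkcond /=.
by apply: eq_bigr => x' _; rewrite inE Fx eq_sym; case: (_ == _).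
Qed.

Lemma few_color_bound (n m : nat) (c : 'I_n -> 'I_n -> 'I_m) :
  (forall a a' b b', a <> a' -> b <> b' ->
    c a b = c a' b -> c a b' = c a' b' -> False) ->
  (n <= 2 * m)%N.
Proof.
move=> hc; case: (posnP n) => [->//|n0].
pose S := (\sum_(b < n) \sum_(a < n) \sum_(a' < n) (c a b == c a' b))%N.
have const (x : nat) : (\sum_(b < n) x = n * x)%N.
  by rewrite sum_nat_const card_ord.
(* In each column, [d ^ 2 + 4 >= 4 * d] is summed over the color multiplicities [d]; it is tight at
   [d = 2], the average when [n = 2 * m]. *)
have lower : (n * (4 * n) <= S + n * (4 * m))%N.
  rewrite -!const.
  rewrite -big_split /=; apply: leq_sum => b _.
  rewrite (sum_fiber_sqr (c^~ b)) -{1}(card_ord n) -(sum_fiber (c^~ b)).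
  have -> : (4 * m = \sum_(y < m) 4)%N by rewrite sum_nat_const card_ord mulnC.
  rewrite big_distrr -big_split /=; apply: leq_sum => y _.
  rewrite -mulnn; by case: #|_| => [|[|d]]; nia.
(* A row agrees with itself in [n] columns and with each other row in at most one. *)
have upper : (S <= n * (n + n.-1))%N.
  rewrite /S exchange_big -const; apply: leq_sum => a _.
  rewrite exchange_big (bigD1 a) //=; apply: leq_add.
    by rewrite -[leqRHS]muln1 -const; apply: leq_sum => b _; case: (_ == _).
  have -> : n.-1 = (\sum_(a' | a' != a) 1)%N.
    by rewrite sum1_card cardC1 card_ord.
  apply: leq_sum => a' aa.
  have -> : (\sum_b (c a b == c a' b) = #|[set b | c a b == c a' b]|)%N.
    rewrite -sum1_card [RHS]big_mkcond; apply: eq_bigr => b _.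
    by rewrite inE; case: (_ == _).
  apply/card_le1_eqP => b b'; rewrite !inE.
  move=> /eqP e1 /eqP e2; apply/eqP/negPn/negP => /eqP bb.
  by case: (hc a a' b b') => // e; [rewrite e eqxx in aa|case: bb].
nia.
Qed.

Lemma r_odd_lower (k n : nat) : (2 <= k)%N ->
  (n <= 2 * r_odd (K_balanced k n) (K_1122_edge k))%N.
Proof.
move=> k2; rewrite /r_odd; case: ex_minnP => m /existsP[col odd_col] _.
have pk : (k - 2 < k)%N by lia.
have qk : (k - 1 < k)%N by lia.
(* A positive [n] provides the index [ord0] that fills the fixed coordinates. *)
case: n => [//|n] in col odd_col *.
apply: (few_color_bound (c := fun x y =>
  cell_color col (rect [ffun=> ord0] (Ordinal pk) (Ordinal qk) x y))).
by move=> a a' b b' aa bb; exact: odd_coloring_no_parallel.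
Qed.

(** * Upper bound and the limit *)

Lemma r_odd_upper (k h : nat) : (2 <= k)%N -> exists D : nat, forall n : nat,
  (h.*2.+3 * r_odd (K_balanced k n) (K_1122_edge k) <= h.+2 * n + D)%N.
Proof.
move=> k2; have [N [L [N0 [L0 hw]]]] := strong_coloring k h.
(* With [r = 2h + 3] and [w] the quotient of [n] by [r * N * L], the size of [T] is at least [n] and
   exceeds it by at most [r * N * (L + 1)]. *)
exists (h.+2 * (h.*2.+3 * N * L.+1))%N => n.
have M0 : (0 < h.*2.+3 * N * L)%N by rewrite !muln_gt0 N0 L0.
have [T [C [c [par cross cT cC]]]] := hw (n %/ (h.*2.+3 * N * L))%N.
have nE := divn_eq n (h.*2.+3 * N * L).
have nlt := ltn_pmod n M0.
move: nE nlt cT cC; move: (n %/ _)%N (n %% _)%N => w r nE nlt cT cC.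
have nT : (n <= #|T|)%N by rewrite cT; nia.
have := strong_odd_colorable k2 par cross nT.
rewrite /r_odd; case: ex_minnP => m _ min /min; rewrite cC => mle.
have := leq_mul (leqnn h.*2.+3) mle; nia.
Qed.

Local Open Scope classical_set_scope.
Local Open Scope ring_scope.

Theorem theorem2 (R : realType) (k : nat) (hk : (2 <= k)%N) :
  exists g : nat -> R,
    (forall n : nat,
       (r_odd (K_balanced k n) (K_1122_edge k))%:R = n%:R / 2 + g n) /\
    g n / n%:R @[n --> \oo] --> (0 : R).
Proof.
pose r n := r_odd (K_balanced k n) (K_1122_edge k).
exists (fun n => (r n)%:R - n%:R / 2); split=> [n|].
  by rewrite addrC subrK.
apply/cvgrPdist_le => eps eps0.
(* This makes [1 / (2h + 3)], the eventual bound on the relative error, at most [eps]. *)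
pose h := Num.truncn eps^-1.
have heps : 1 <= (h.*2.+3)%:R * eps.
  have h1 : eps^-1 <= (h.*2.+3)%:R.
    apply: (le_trans (ltW (truncnS_gt _))); rewrite ler_nat -/h -addnn; lia.
  by rewrite -[leLHS](mulVf (lt0r_neq0 eps0)) ler_wpM2r // ltW.
have [D hD] := r_odd_upper h hk.
near=> n.
have n0 : (0 < n)%N by near: n; exact: nbhs_infty_gt.
have nD : (2 * D <= n)%N by near: n; exact: nbhs_infty_ge.
have nR : (0 : R) < n%:R by rewrite ltr0n.
have lo : n%:R <= 2 * (r n)%:R :> R.
  by rewrite -natrM ler_nat; exact: r_odd_lower.
(* Twice the bound [hD], with [2 * D <= n] absorbed through [2(h + 2) + 1 = (2h + 3) + 2]. *)
have up : (h.*2.+3)%:R * (r n)%:R * 2 <= (h.*2.+3)%:R * n%:R + 2 * n%:R :> R.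
  rewrite -!natrM -natrD ler_nat; have := hD n; rewrite -/(r n); nia.
rewrite sub0r normrN ger0_norm; last by apply: divr_ge0; [lra|exact: ltW].
rewrite ler_pdivrMr //.
have H0 : (0 : R) < (h.*2.+3)%:R by rewrite ltr0n.
rewrite -(ler_pM2l H0).
have : n%:R <= (h.*2.+3)%:R * eps * n%:R :> R by rewrite ler_peMl // ltW.
rewrite mulrBr mulrA; lra.
Unshelve. all: by end_near.
Qed.
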